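(* Let $(a_n)$ be an arithmetic sequence and let $(d_n)$ be the associated non-arithmetic sequence. If $(a_n)$ is weakly dli, then $|t^{s}_{(d_n)}(\mathbb{T})|=\mathfrak{c}$, where $\mathfrak{c}$ is the cardinality of the continuum.
   Context: $\mathbb{N}=\{1,2,3,\dots\}$ and $\mathbb{T}=\mathbb{R}/\mathbb{Z}$ is the circle group. For $A\subseteq\mathbb{N}$, the natural density is $d(A)=\lim_{n\to\infty}\frac{|A\cap[0,n-1]|}{n}$ when the limit exists. For $A\subseteq\mathbb{N}$ and an integer $m\ge0$, $A-m=\{n\in\mathbb{N}: n=a-m\text{ for some }a\in A\}$. An arithmetic sequence is a sequence of positive integers $(a_n)_{n\ge 0}$ with $1=a_0<a_1<a_2<\dots$ and $a_n\mid a_{n+1}$ for every $n$. Its ratios are $b_n=a_n/a_{n-1}$ for $n\ge1$ (so $b_1=a_1$ and $b_n\ge 2$). The associated sequence $(d_n)_{n\ge1}$ is the increasing enumeration of the set $\{r a_k : k\ge 0,\ 1\le r<b_{k+1}\}$. Write $a_k=d_{n_k}$; thus $n_0=1$, $n_{k+1}-n_k=b_{k+1}-1$, and $d_{n_k+r-1}=ra_k$ for $1\le r\le b_{k+1}-1$. The lifting function $L:\mathcal{P}(\mathbb{N})\to\mathcal{P}(\mathbb{N})$ is $L(A)=\bigcup_{k\in A}[n_{k-1},n_k-1]$ (integer intervals). $(a_n)$ is weakly dli (weakly density lifting invariant) if there exists an infinite $A\subseteq\mathbb{N}$ such that $d(L(A-m))=0$ for each $m\in\mathbb{N}\cup\{0\}$.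 For a sequence of integers $(u_n)$, $t^s_{(u_n)}(\mathbb{T})=\{x\in\mathbb{T}: u_nx\to 0\text{ statistically in }\mathbb{T}\}$, meaning that for every $\varepsilon>0$, $d(\{n\in\mathbb{N}:\|u_nx\|\ge\varepsilon\})=0$, with $\|y\|$ the distance from $y$ to the nearest integer. *)

(* Defs.v *)
From HB Require Import structures.
From mathcomp Require Import all_boot all_order all_algebra generic_quotient ring_quotient.
From mathcomp Require Import all_classical all_reals all_analysis.

Set Implicit Arguments.
Unset Strict Implicit.
Unset Printing Implicit Defensive.

Import Order.TTheory GRing.Theory Num.Theory.
Import numFieldNormedType.Exports.

Local Open Scope classical_set_scope.
Local Open Scope ring_scope.

(* The convention is N = {1, 2, 3, ...}: subsets of N are values of [set nat]
   not containing 0, and a sequence (u_n)_{n >= 1} is a function on [nat] whose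
   value at 0 is irrelevant. *)
Definition posN : set nat := [set n | (0 < n)%N].

Definition has_density (R : realType) (A : set nat) (l : R) : Prop :=
  (fun n : nat => #|[set i : 'I_n | (i : nat) \in A]|%:R / n%:R : R)
    @ \oo --> l.

Definition shift_down (A : set nat) (m : nat) : set nat :=
  [set n | posN n /\ A (n + m)%N].

Definition arithmetic_seq (a : nat -> nat) : Prop :=
  [/\ a 0 = 1%N, forall n, (a n < a n.+1)%N & forall n, (a n %| a n.+1)%N].

Definition ratio (a : nat -> nat) (n : nat) : nat := (a n %/ a n.-1)%N.

Definition least (S : set nat) : nat :=
  xget 0%N [set x | S x /\ forall y, S y -> (x <= y)%N].

(* For S an infinite subset of N, [enumeration S 1 < enumeration S 2 < ...] are
   the elements of S; the value at 0 is the sentinel 0. *)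
Fixpoint enumeration (S : set nat) (n : nat) : nat :=
  if n is m.+1 then least (S `&` [set x | (enumeration S m < x)%N]) else 0%N.

Definition assoc_set (a : nat -> nat) : set nat :=
  [set x | exists k r, [/\ (1 <= r)%N, (r < ratio a k.+1)%N & x = (r * a k)%N]].

Definition assoc_seq (a : nat -> nat) : nat -> nat := enumeration (assoc_set a).

(* The n_k with a_k = d_{n_k}. *)
Definition assoc_index (a : nat -> nat) (k : nat) : nat :=
  xget 0%N [set n | posN n /\ assoc_seq a n = a k].

Definition lifting (a : nat -> nat) (A : set nat) : set nat :=
  \bigcup_(k in A)
    [set m | (assoc_index a k.-1 <= m <= assoc_index a k - 1)%N].

Definition weakly_dli (R : realType) (a : nat -> nat) : Prop :=
  exists A : set nat, [/\ A `<=` posN, infinite_set A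
    & forall m : nat, has_density (lifting a (shift_down A m)) (0 : R)].

(* [Num.int], as a predicate carrying its subgroup structure. *)
Definition int_subgroup (R : realType) : zmodClosed R :=
  GRing.ZmodClosed.clone R Num.int_num_subdef _.

Definition circle (R : realType) : zmodType :=
  {ideal_quot (int_subgroup R)}.

Definition dist_int (R : realType) (x : R) : R :=
  inf [set `|x - z%:~R| | z in [set: int]].

(* [repr] picks a representative; by [circle_norm_pi] below, the choice is
   immaterial. *)
Definition circle_norm (R : realType) (y : circle R) : R :=
  dist_int (repr (y : {ideal_quot (int_subgroup R)})).

Definition stat_cvg0 (R : realType) (y : nat -> circle R) : Prop :=
  forall e : R, 0 < e ->
    has_density [set n | posN n /\ e <= circle_norm (y n)] (0 : R).

Definition stat_char (R : realType) (u : nat -> int) : set (circle R) :=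
  [set x | stat_cvg0 (fun n => x *~ u n)].
Arguments stat_char R u : clear implicits.

Lemma circle_norm_pi (R : realType) (x : R) :
  circle_norm (\pi_({ideal_quot (int_subgroup R)})%qT x : circle R) =
  dist_int x.
Proof.
rewrite /circle_norm; case: piP => y xy.
have : (x - y) \is a Num.int.
  by move/eqP: xy; rewrite -Quotient.idealrBE.
move=> /intrP[m xym].
have -> : x = y + m%:~R by rewrite -xym addrC subrK.
rewrite /dist_int; congr inf; apply/seteqP; split=> _ [z _ <-] /=.
- exists (z + m) => //.
  by rewrite intrD opprD addrACA subrr addr0.
- exists (z - m) => //.
  by rewrite intrD mulrNz opprD opprK -addrA (addrC m%:~R) addrA.
Qed.

Lemma leastP (S : set nat) : S !=set0 ->
  S (least S) /\ forall y, S y -> (least S <= y)%N.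
Proof.
move=> S0; rewrite /least; apply: (@xgetPex _ 0%N [set x | S x /\ _]) => /=.
have h : exists n, `[< S n >] by case: S0 => x Sx; exists x; apply/asboolP.
case: (ex_minnP h) => m /asboolP Sm mP; exists m; split => // y Sy.
by apply: mP; apply/asboolP.
Qed.

Lemma enumerationS (S : set nat) (n : nat) :
  (forall x, exists2 y, S y & (x < y)%N) ->
  [/\ S (enumeration S n.+1), (enumeration S n < enumeration S n.+1)%N
    & forall y, S y -> (enumeration S n < y)%N ->
        (enumeration S n.+1 <= y)%N].
Proof.
move=> Sinf /=; set T := S `&` _.
have [|[ST lT] minT] := @leastP T.
  by have [y Sy yn] := Sinf (enumeration S n); exists y; split.
by split=> // y Sy ny; apply: minT.
Qed.

Lemma enumeration_range (S : set nat) :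
  S `<=` posN -> (forall x, exists2 y, S y & (x < y)%N) ->
  enumeration S @` posN = S.
Proof.
move=> Spos Sinf; apply/seteqP; split=> [_ [[//|n] _ <-]|y Sy].
  by case: (enumerationS n Sinf).
have ge_id n : (n <= enumeration S n)%N.
  elim: n => // n IH; apply: leq_ltn_trans IH _.
  by case: (enumerationS n Sinf).
have h : exists n, (y <= enumeration S n)%N by exists y.
case: (ex_minnP h) => -[|m] ym mmin.
  by have := leq_trans (Spos _ Sy) ym.
exists m.+1 => //; apply/eqP; rewrite eqn_leq ym andbT.
have [_ _ -> //] := enumerationS m Sinf.
by rewrite ltnNge; apply/negP => /mmin; rewrite ltnn.
Qed.

Section AssociatedSequence.
Variables (a : nat -> nat) (ha : arithmetic_seq a).

Let a0 : a 0%N = 1%N. Proof. by case: ha. Qed.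
Let a_lt n : (a n < a n.+1)%N. Proof. by case: ha. Qed.

Let a_mono m n : (m <= n)%N -> (a m <= a n)%N.
Proof.
move=> /subnK <-; elim: (n - m)%N => // k IH.
by rewrite addSn (leq_trans IH) // ltnW.
Qed.

Let a_gt0 n : (0 < a n)%N.
Proof. by apply: leq_trans (a_mono (leq0n n)); rewrite a0. Qed.

Let a_ge n : (n < a n)%N.
Proof. by elim: n => // n IH; apply: leq_ltn_trans IH _. Qed.

Let a_dvd m n : (m <= n)%N -> (a m %| a n)%N.
Proof.
move=> /subnK <-; elim: (n - m)%N => // k IH.
by rewrite addSn (dvdn_trans IH) //; case: ha.
Qed.

Let aS k : a k.+1 = (ratio a k.+1 * a k)%N.
Proof. by rewrite /ratio /= divnK // a_dvd. Qed.

Let ratio_gt1 k : (1 < ratio a k.+1)%N.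
Proof. by move: (a_lt k); rewrite aS -{1}[a k]mul1n ltn_pmul2r. Qed.

Let a_assoc k : assoc_set a (a k).
Proof. by exists k, 1%N; split => //; rewrite mul1n. Qed.

Lemma assoc_set_posN : assoc_set a `<=` posN.
Proof. by move=> _ [k [r [r1 _ ->]]]; rewrite /posN /= muln_gt0 r1 a_gt0. Qed.

Lemma assoc_set_unbounded x : exists2 y, assoc_set a y & (x < y)%N.
Proof. by exists (a x). Qed.

Lemma assoc_seqS n :
  [/\ assoc_set a (assoc_seq a n.+1), (assoc_seq a n < assoc_seq a n.+1)%N
    & forall y, assoc_set a y -> (assoc_seq a n < y)%N ->
        (assoc_seq a n.+1 <= y)%N].
Proof. exact: enumerationS assoc_set_unbounded. Qed.

Lemma assoc_seq_range : assoc_seq a @` posN = assoc_set a.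
Proof. exact: enumeration_range assoc_set_posN assoc_set_unbounded. Qed.

Lemma assoc_seq_inj : injective (assoc_seq a).
Proof.
have mono : {homo assoc_seq a : m n / (m < n)%N}.
  apply: homo_ltn => [y x z|i]; first exact: ltn_trans.
  by case: (assoc_seqS i).
by move=> m n; case: (ltngtP m n) => // /mono h e;
  by move: h; rewrite e ltnn.
Qed.

Lemma assoc_indexP k :
  posN (assoc_index a k) /\ assoc_seq a (assoc_index a k) = a k.
Proof.
apply: (@xgetPex _ 0%N [set n | posN n /\ assoc_seq a n = a k]).
have : assoc_set a (a k) by [].
by rewrite -assoc_seq_range => -[n n0 ?]; exists n.
Qed.

Lemma assoc_index_unique k n : assoc_seq a n = a k -> assoc_index a k = n.
Proof. by move=> e; apply: assoc_seq_inj; rewrite e; case: (assoc_indexP k). Qed.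

Lemma assoc_index0 : assoc_index a 0 = 1%N.
Proof.
apply: assoc_index_unique; have [h1 h2 h3] := assoc_seqS 0.
by apply/eqP; rewrite eqn_leq h3 // a0.
Qed.

Lemma assoc_seq_block k r : (r < ratio a k.+1)%N ->
  assoc_seq a (assoc_index a k + r)%N = (r.+1 * a k)%N.
Proof.
elim: r => [_|r IH rb]; first by rewrite addn0 mul1n; case: (assoc_indexP k).
rewrite addnS; have {}IH := IH (ltnW rb).
have [[j [s [s1 sb e]]] h2 h3] := assoc_seqS (assoc_index a k + r).
apply/eqP; rewrite eqn_leq; apply/andP; split.
  apply: h3; last by rewrite IH ltn_pmul2r.
  move: rb; rewrite leq_eqVlt => /orP[/eqP rb|rb]; last by exists k, r.+2.
  by rewrite rb -aS.
rewrite {}IH {}e in h2 *; case: (leqP k j) => kj.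
  have /dvdnP[q aj] := a_dvd kj.
  by move: h2; rewrite aj mulnA ltn_pmul2r // leq_pmul2r.
suff : (s * a j < r.+1 * a k)%N by move=> /(ltn_trans h2); rewrite ltnn.
apply: leq_trans (_ : a k <= _)%N; last by rewrite leq_pmull.
by apply: leq_trans (a_mono kj); rewrite aS ltn_pmul2r.
Qed.

Lemma assoc_indexS k :
  assoc_index a k.+1 = (assoc_index a k + (ratio a k.+1).-1)%N.
Proof.
apply: assoc_index_unique; rewrite assoc_seq_block ?prednK -?aS //.
exact: ltnW (ratio_gt1 k).
all: exact: ltnW (ratio_gt1 k).
Qed.

End AssociatedSequence.

(* Main.v *)
Require Import Defs.
From mathcomp Require Import all_boot all_order all_algebra.
From mathcomp Require Import generic_quotient ring_quotient.
From mathcomp Require Import all_classical all_reals all_analysis.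
From mathcomp Require Import zify lra.

(** Let the infinite set A witness that (a_n) is weakly dli.  For B included in
    A, put x_B = sum_(j in B) 1 / a_j.  If d_n = r a_(k-1) with r < b_k, then
    modulo 1 only the terms with j >= k contribute to d_n x_B, so that
    ||d_n x_B|| <= a_k sum_(j in B, j >= k) 1 / a_j.  This is at most 2^(1-m)
    when none of k, ..., k + m - 1 is in A, that is, when n is outside the
    union of the density-zero sets L(A - i), i < m.  Hence every x_B is in the
    characterized subgroup.  Keeping only the elements of A that are at least 2
    and have a fixed parity, B |-> x_B mod 1 becomes injective: the tail after
    an omitted index j of A is at most 2 / a_(j+2) <= 1 / (2 a_j), and
    all the sums are in [0, 1/2]. *)

Set Implicit Arguments.
Unset Strict Implicit.
Unset Printing Implicit Defensive.

Import Order.TTheory GRing.Theory Num.Theory.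
Import numFieldNormedType.Exports.

Local Open Scope ring_scope.
Local Open Scope classical_set_scope.
Local Open Scope card_scope.

(** * Cardinal comparisons *)

Lemma card_le_inj (T U : Type) (A : set T) (B : set U) (f : T -> U) :
  {in A &, injective f} -> {in A, forall x, B (f x)} -> A #<= B.
Proof.
move=> finj fAB; apply/card_subP; exists (f @` A); first exact: inj_card_eq.
by move=> _ [x Ax <-]; apply: fAB; rewrite inE.
Qed.

(** A real is determined by its lower cut of rationals, coded as naturals by [pickle]; a rational
    strictly between two reals separates their cuts. *)
Lemma real_card_le_powerset_nat (R : realType) : [set: R] #<= [set: set nat].
Proof.
apply: (@card_le_inj _ _ _ _ (fun x : R => [set n | exists2 q : rat,
  pickle q = n & ratr q < x])) => // x y _ _.
wlog: x y / x < y => [hw xy | xy e].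
  by case: (ltgtP x y) => // /hw; [apply | move=> <-].
have [q] := rat_in_itvoo xy; rewrite in_itv /= => /andP[xq qy].
have : [set n | exists2 q : rat, pickle q = n & ratr q < y] (pickle q).
  by exists q.
rewrite -e => -[q' /(pcan_inj pickleK) ->] /(lt_trans xq).
by rewrite ltxx.
Qed.

(** * The ideal of density-zero sets *)

Lemma has_density0_sub (R : realType) (E F : set nat) :
  E `<=` F -> has_density F (0 : R) -> has_density E (0 : R).
Proof.
move=> EF; rewrite /has_density => F0.
apply: (squeeze_cvgr _ (cvg_cst 0) F0); near=> n.
rewrite divr_ge0 //= ler_wpM2r ?invr_ge0 // ler_nat.
apply: subset_leq_card; apply/fintype.subsetP => i.
by rewrite !in_setE /= !in_setE; apply: EF.
Unshelve. all: by end_near. Qed.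

Lemma has_density0U (R : realType) (E F : set nat) :
  has_density E (0 : R) -> has_density F (0 : R) ->
  has_density (E `|` F) (0 : R).
Proof.
pose c (A : set nat) n : R := #|[set i : 'I_n | (i : nat) \in A]|%:R / n%:R.
move=> E0 F0; have EF0 : c E n + c F n @[n --> \oo] --> (0 : R).
  by rewrite -[X in _ --> X]addr0; apply: cvgD.
apply: (squeeze_cvgr _ (cvg_cst 0) EF0); near=> n.
rewrite divr_ge0 //= -mulrDl ler_wpM2r ?invr_ge0 // -natrD ler_nat.
rewrite -cardUI; apply: leq_trans (leq_addr _ _).
apply: subset_leq_card; apply/fintype.subsetP => i.
by move=> /set_mem /set_mem [Ei|Fi]; apply/orP; [left|right];
  do 2!apply: mem_set.
Unshelve. all: by end_near. Qed.

(** Finite unions suffice: for a given tolerance only finitely many shifts of A are used. *)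
Lemma has_density0_bigcup (R : realType) (E : nat -> set nat) (m : nat) :
  (forall i, has_density (E i) (0 : R)) ->
  has_density (\bigcup_(i in `I_m) E i) (0 : R).
Proof.
move=> E0; elim: m => [|m IH].
  rewrite II0 bigcup_set0; apply: cvg_near_cst; near=> n.
  rewrite [#|_|]eq_card0 ?mul0r // => i.
  by apply/negbTE/negP => /set_mem/set_mem.
rewrite IIS bigcup_setU bigcup_set1; exact: has_density0U.
Unshelve. all: by end_near. Qed.

(** * Subsums of the series of 1 / a_j *)

Definition recip_psum (R : realType) (a : nat -> nat) (B : set nat) (n : nat)
    : R :=
  \sum_(j < n) (\1_B (j : nat) / (a j)%:R).

(** The partial sums increase and are bounded, so this supremum is the sum x_B of the series; bounds
    on all partial sums pass to it at once. *)
Definition recip_sum (R : realType) (a : nat -> nat) (B : set nat) : R :=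
  sup (range (recip_psum R a B)).

Section RecipSum.
Variables (R : realType) (a : nat -> nat).
Hypothesis ha : arithmetic_seq a.

Local Notation u := (recip_psum R a).
Local Notation x := (recip_sum R a).

Lemma arithmetic_seq_gt0 n : (0 < a n)%N.
Proof.
case: ha => a0 alt _; case: n => [|n]; rewrite ?a0 //.
exact: leq_ltn_trans (alt n).
Qed.

Lemma arithmetic_seq_dvd m n : (m <= n)%N -> (a m %| a n)%N.
Proof.
move=> /subnK <-; elim: (n - m)%N => // k IH.
by rewrite addSn (dvdn_trans IH) //; case: ha.
Qed.

Lemma arithmetic_seq_double n : (2 * a n <= a n.+1)%N.
Proof.
have [_ /(_ n) alt /(_ n) /dvdnP[q e]] := ha.
rewrite e leq_pmul2r ?arithmetic_seq_gt0 //.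
by move: alt; rewrite e -{1}[a n]mul1n ltn_pmul2r ?arithmetic_seq_gt0.
Qed.

Lemma arithmetic_seq_expn m n : (2 ^ m * a n <= a (n + m))%N.
Proof.
elim: m => [|m IH]; first by rewrite mul1n addn0.
rewrite addnS (leq_trans _ (arithmetic_seq_double _)) //.
by rewrite expnS -mulnA leq_mul2l.
Qed.

Let aR_gt0 n : 0 < (a n)%:R :> R.
Proof. by rewrite ltr0n arithmetic_seq_gt0. Qed.

Lemma recip_psumS B n : u B n.+1 = u B n + \1_B n / (a n)%:R.
Proof. by rewrite /recip_psum big_ord_recr. Qed.

Lemma recip_psum_homo B : {homo u B : m n / (m <= n)%N >-> m <= n}.
Proof.
apply: homo_leq => [//|y v w|n]; first exact: le_trans.
by rewrite recip_psumS lerDl divr_ge0 // indicE.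
Qed.

Lemma recip_psum_stable B m n : (m <= n)%N ->
  (forall j, (m <= j < n)%N -> ~ B j) -> u B n = u B m.
Proof.
move=> /subnKC <-; elim: (n - m)%N => [|k IH] hB; first by rewrite addn0.
rewrite addnS recip_psumS IH => [|j /andP[mj jk]].
  by rewrite indicE memNset ?mul0r ?addr0 //; apply: hB; lia.
by apply: hB; lia.
Qed.

(** Since a at least doubles, 1 / a_n + 2 / a_(n+1) <= 2 / a_n, so adding 2 / a_n turns the partial
    sums into a nonincreasing sequence. Hence 2 / a_m bounds every tail from m on. *)
Lemma recip_psum_tail B m n : (m <= n)%N ->
  u B n + 2 / (a n)%:R <= u B m + 2 / (a m)%:R.
Proof.
move=> /subnKC <-; elim: (n - m)%N => [|k IH]; first by rewrite addn0.
apply: le_trans IH; rewrite addnS recip_psumS -addrA lerD2l.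
have : \1_B (m + k)%N <= 1 :> R by rewrite indicE lern1 leq_b1.
have : ((a (m + k).+1)%:R)^-1 <= (2 * (a (m + k)%N)%:R)^-1 :> R.
  rewrite lef_pV2 ?posrE ?mulr_gt0 //.
  by rewrite -natrM ler_nat arithmetic_seq_double.
rewrite invfM; have := aR_gt0 (m + k); rewrite -invr_gt0.
move: (_^-1) (_^-1) (\1_ _ _) => p q r; nra.
Qed.

Lemma recip_psum_bound B m n : u B n <= u B m + 2 / (a m)%:R.
Proof.
case: (leqP m n) => mn.
  by apply: le_trans (recip_psum_tail B mn); rewrite lerDl divr_ge0.
by apply: (le_trans (recip_psum_homo B (ltnW mn))); rewrite lerDl divr_ge0.
Qed.

Lemma recip_sum_le B n : x B <= u B n + 2 / (a n)%:R.
Proof.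
apply: ge_sup; first by exists (u B 0); exists 0%N.
by move=> _ [m _ <-]; apply: recip_psum_bound.
Qed.

Lemma recip_sum_ge B n : u B n <= x B.
Proof.
apply: ub_le_sup; last by exists n.
by exists (u B 0 + 2 / (a 0%N)%:R) => _ [m _ <-]; apply: recip_psum_bound.
Qed.

(** At the first difference j, B gains 1 / a_j, while C, having neither j nor j + 1, can still gain
    at most 2 / a_(j+2) <= 1 / (2 a_j). *)
Lemma recip_sum_lt (B C : set nat) j :
    (forall i, (i < j)%N -> B i = C i) -> B j -> ~ C j -> ~ C j.+1 ->
  x C < x B.
Proof.
move=> BC Bj Cj CSj.
have uBC : u B j = u C j.
  apply: eq_bigr => i _; rewrite !indicE; congr ((nat_of_bool _)%:R / _).
  by apply/idP/idP; rewrite !inE BC.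
have uC : u C j.+2 = u C j.
  apply: recip_psum_stable => [|i]; first by rewrite -addn2 leq_addr.
  rewrite ltnS leq_eqVlt => /andP[] /orP[/eqP <- //|ji ij].
  by have -> : i = j.+1 by lia.
have := recip_sum_le C j.+2; have := recip_sum_ge B j.+1.
rewrite recip_psumS uC uBC indicE mem_set // mul1r.
suff : 2 / (a j.+2)%:R < (a j)%:R^-1 :> R by lra.
have := arithmetic_seq_expn 2 j; rewrite addn2.
have := aR_gt0 j; have := aR_gt0 j.+2; rewrite -(ler_nat R) natrM => p q h.
by rewrite ltr_pdivrMr // ltr_pdivlMl //; lra.
Qed.

(** At a first difference n, one set contains n, so n + 1 is not in A and hence not in the other
    set: the strict comparison applies. *)
Lemma recip_sum_inj_sparse (A B C : set nat) :
    (forall j, A j -> ~ A j.+1) -> B `<=` A -> C `<=` A ->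
  x B = x C -> B = C.
Proof.
move=> sparse BA CA xBC.
have BC n i : (i < n)%N -> B i = C i.
  elim: n i => // n IH i.
  rewrite ltnS leq_eqVlt => /orP[/eqP -> {i}|]; last exact: IH.
  apply/propext; split=> [Bn|Cn]; apply: contrapT => h.
    suff : x C < x B by rewrite xBC ltxx.
    by apply: (recip_sum_lt IH Bn h) => /CA; apply/sparse/BA.
  suff : x B < x C by rewrite xBC ltxx.
  apply: (@recip_sum_lt C B n _ Cn h) => [i /IH //|/BA]; exact/sparse/CA.
by apply/funext => i; apply: (BC i.+1).
Qed.

(** The whole sum is a tail from 2, at most 2 / a_2 <= 2 / (4 a_0). An interval shorter than 1 makes
    reduction modulo 1 injective. *)
Lemma recip_sum_itv B : ~ B 0%N -> ~ B 1%N -> 0 <= x B <= 2^-1.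
Proof.
move=> B0 B1; have u2 : u B 2 = 0.
  rewrite (recip_psum_stable (m := 0)) //.
    by rewrite /recip_psum big_ord0.
  by case=> [|[|]].
have := recip_sum_le B 2; have := recip_sum_ge B 2; rewrite u2 => -> /= h.
apply: le_trans h _; rewrite add0r.
have := arithmetic_seq_expn 2 0; rewrite add0n -(ler_nat R) natrM.
have : (1 <= a 0)%N by exact: arithmetic_seq_gt0.
rewrite -(ler_nat R) => p q; rewrite ler_pdivrMr //; lra.
Qed.

(** * Multiples of x_B by d_n modulo 1 *)

Lemma recip_psum_int B k : (a k)%:R * u B k.+1 \is a Num.int.
Proof.
rewrite /recip_psum mulr_sumr; apply: rpred_sum => j _.
have /dvdnP[q ->] := @arithmetic_seq_dvd j k (ltn_ord j).
rewrite natrM mulrCA mulfK ?gt_eqF // mulrC indicE -natrM.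
by apply: rpredMn; apply: rpred1.
Qed.

(** The offset r starts at 0, so d_n = (r + 1) a_k; the block has b_(k+1) - 1 elements, whence the
    bound on r + 1. *)
Lemma assoc_index_block n : (0 < n)%N -> exists k r,
  [/\ (r.+1 < Defs.ratio a k.+1)%N, n = (assoc_index a k + r)%N &
      (n < assoc_index a k.+1)%N].
Proof.
have idx_lt k : (assoc_index a k < assoc_index a k.+1)%N.
  rewrite assoc_indexS // -[X in (X < _)%N]addn0 ltn_add2l.
  rewrite -subn1 subn_gt0 leq_divRL ?arithmetic_seq_gt0 //.
  exact: arithmetic_seq_double.
move=> n0.
have h : exists k, (n < assoc_index a k)%N.
  exists n; elim: n {n0} => [|n IH]; first by rewrite assoc_index0.
  exact: leq_ltn_trans IH _.
case: (ex_minnP h) => -[|k] nk kmin.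
  by move: nk; rewrite assoc_index0 // ltnS leqNgt n0.
have kn : (assoc_index a k <= n)%N.
  by rewrite leqNgt; apply/negP => /kmin; rewrite ltnn.
exists k, (n - assoc_index a k)%N; rewrite subnKC //; split=> //.
by move: nk; rewrite assoc_indexS //; lia.
Qed.

Lemma dist_int_assoc_seq (A B : set nat) m n : B `<=` A -> (0 < n)%N ->
  (forall i, (i < m)%N -> ~ lifting a (shift_down A i) n) ->
  dist_int (x B *+ assoc_seq a n) <= 2 / 2 ^+ m.
Proof.
move=> BA n0 nL; have [k [r [rb en nlt]]] := assoc_index_block n0.
(* The block of n is the one lifted from k + 1. An index j of B in this range would put k + 1 in A -
   (j - k - 1), and so n in its lifting. *)
have stab : u B (k.+1 + m) = u B k.+1.
  apply: recip_psum_stable; first exact: leq_addr.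
  move=> j /andP[kj jm] /BA Aj; apply: (nL (j - k.+1)%N); first by lia.
  exists k.+1; first by split=> //; rewrite subnKC.
  by rewrite /= en leq_addr /= -en; lia.
have /intrP[z uz] := recip_psum_int B k.
have := recip_sum_le B (k.+1 + m); have := recip_sum_ge B k.+1; rewrite stab.
set d := assoc_seq a n => xge xle.
have dE : d = (r.+1 * a k)%N by rewrite /d en assoc_seq_block //; exact: ltnW.
have dlt : (d <= a k.+1)%N.
  have [_ _ /(_ k)/divnK <-] := ha.
  by rewrite dE leq_pmul2r ?arithmetic_seq_gt0 // ltnW.
(* The integer compared with is d times the partial sum up to index k, because a_k divides d. What
   remains is d <= a_(k+1) times a tail from k + 1 + m. *)
apply: (@le_trans _ _ `|x B *+ d - (z *+ r.+1)%:~R|).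
  apply: ge_inf; last by exists (z *+ r.+1).
  by exists 0 => _ [w _ <-].
have -> : (z *+ r.+1)%:~R = u B k.+1 *+ d.
  by rewrite rmorphMn /= -uz dE mulnC mulrnA mulr_natl.
rewrite -mulrnBl ger0_norm ?mulrn_wge0 ?subr_ge0 // -[_ *+ d]mulr_natl.
apply: (@le_trans _ _ ((a k.+1)%:R * (2 / (a (k.+1 + m))%:R))).
  by apply: ler_pM; rewrite ?subr_ge0 ?ler_nat // lerBlDl.
rewrite mulrCA ler_wpM2l // ler_pdivrMr // mulrC ler_pdivlMr ?exprn_gt0 //.
by have := arithmetic_seq_expn m k.+1; rewrite -(ler_nat R) natrM natrX mulrC.
Qed.

Lemma stat_char_recip_sum (A B : set nat) : B `<=` A ->
    (forall m, has_density (lifting a (shift_down A m)) (0 : R)) ->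
  stat_char R (fun n => Posz (assoc_seq a n))
    (\pi_({ideal_quot (int_subgroup R)})%qT (x B) : circle R).
Proof.
move=> BA hA e e0.
have [m me] : exists m, 2 / 2 ^+ m < e.
  exists (Num.bound (2 / e)); rewrite ltr_pdivrMr ?exprn_gt0 //.
  rewrite -ltr_pdivrMl // mulrC.
  have /archi_boundP/lt_trans -> // : 0 <= 2 / e by rewrite divr_ge0 // ltW.
  by rewrite -natrX ltr_nat ltn_expl.
(* The exceptional n all lie in the union of the first m liftings. *)
apply: has_density0_sub (@has_density0_bigcup R _ m hA) => n [n0].
rewrite -pmulrn -raddfMn circle_norm_pi => en; apply: contrapT => nL.
suff : dist_int (x B *+ assoc_seq a n) <= 2 / 2 ^+ m by lra.
by apply: (dist_int_assoc_seq BA) => // i im Li; apply: nL; exists i.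
Qed.

End RecipSum.

(** * Continuum many elements *)

Lemma infinite_parity (A : set nat) : infinite_set A ->
  exists b : bool, infinite_set (A `&` [set k | odd k = b]).
Proof.
move=> Ainf; apply: contrapT => /forallNP fin; apply: Ainf.
have : finite_set ((A `&` [set k | odd k = true])
                   `|` (A `&` [set k | odd k = false])).
  by rewrite finite_setU; split; apply: contrapT; apply: fin.
apply: sub_finite_set => k Ak; case ok: (odd k); [left|right]; by [].
Qed.

Theorem theorem3p8 (R : realType) (a : nat -> nat) (ha : arithmetic_seq a)
    (hdli : weakly_dli R a) :
  stat_char R (fun n : nat => Posz (assoc_seq a n)) #= [set: R].
Proof.
rewrite card_eq_le; apply/andP; split.
  (* Upper bound: choosing representatives injects the circle into the reals. *)
  apply: (@card_le_inj _ _ _ _ (fun y : circle R =>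
    repr (y : {ideal_quot (int_subgroup R)}))) => // y z _ _ e.
  by rewrite -[y](reprK (qT := {ideal_quot (int_subgroup R)})) e reprK.
case: hdli => A [_ Ainf hA]; have [b Abinf] := infinite_parity Ainf.
(* Removing 0 and 1 confines the sums to [0, 1/2]; f then enumerates indices injectively, so that
   every set of naturals S yields a subset of [A']. *)
have := infinite_setD Abinf (finite_II 2).
set A' := _ `\` _ => /infiniteP/pcard_leP[f].
have sparse j : A' j -> ~ A' j.+1.
  by move=> [[_ /= jb] _] [[_ /=]]; rewrite jb; case: (b).
have fA' (S : set nat) : f @` S `<=` A' by move=> _ [n _ <-]; exact: funS.
have A'A : A' `<=` A by move=> k [[]].
apply: card_le_trans (real_card_le_powerset_nat R) _.
apply: (@card_le_inj _ _ _ _ (fun S : set nat =>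
    \pi_({ideal_quot (int_subgroup R)})%qT (recip_sum R a (f @` S))
      : circle R)).
  move=> S T _ _ /eqP; rewrite -Quotient.idealrBE => ST.
  have itv U : 0 <= recip_sum R a (f @` U) <= 2^-1.
    by apply: recip_sum_itv => // /fA' -[_ /=]; apply.
  have {}ST : recip_sum R a (f @` S) = recip_sum R a (f @` T).
    (* The difference is an integer of absolute value at most 1/2, hence 0. *)
    apply/eqP; rewrite -subr_eq0; apply: contrapT => /negP /(norm_intr_ge1 ST).
    rewrite ler_normr; have /andP[? ?] := itv S; have /andP[? ?] := itv T.
    by move=> /orP[] ?; lra.
  have {}ST := recip_sum_inj_sparse ha sparse (fA' _) (fA' _) ST.
  have finj : injective f by move=> i j; apply: inj; rewrite inE.
  by apply/funext => n; rewrite -(image_inj (A := S) finj) ST image_inj.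
move=> S _; apply: stat_char_recip_sum hA => //.
by apply: subset_trans A'A.
Qed.
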